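(* Let $T$ and $A$ be bounded linear operators on a complex Hilbert space $H$, and suppose that $0$ belongs neither to the approximate point spectrum of $A$ nor to that of $A^{*}$. Suppose that $M_T(A)$ is attained at a unit vector $f\in H$, put $$h=Tf-\frac{(Tf,Af)}{(Af,Af)}Af,$$ and assume $h\neq 0$. Then $M_{T^{*}}(A^{*})$ is attained at the unit vector $h/\|h\|$.
   Context: $(\cdot,\cdot)$ is the inner product of $H$ (linear in the first variable) and $\|\cdot\|$ its norm. For a bounded operator $B$, the condition that $0$ is not in the approximate point spectrum of $B$ means that there is $c>0$ with $\|Bx\|\ge c\|x\|$ for all $x\in H$. For bounded operators $S,B$ on $H$ with $0$ not in the approximate point spectrum of $B$, the translatable radius of $S$ in the direction of $B$ is $$M_S(B)=\sup_{\|u\|=1}\left\|Su-\frac{(Su,Bu)}{(Bu,Bu)}Bu\right\| .$$ ''$M_S(B)$ is attained at a unit vector $u$'' means that $\left\|Su-\frac{(Su,Bu)}{(Bu,Bu)}Bu\right\|=M_S(B)$. *)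

(* Defs.v *)
From HB Require Import structures.
From mathcomp Require Import all_boot all_order all_algebra sesquilinear.
From mathcomp Require Import complex.
From mathcomp Require Import all_classical all_reals all_analysis.

Set Implicit Arguments.
Unset Strict Implicit.
Unset Printing Implicit Defensive.

Import Order.TTheory GRing.Theory Num.Theory.
Import numFieldNormedType.Exports.

Local Open Scope classical_set_scope.
Local Open Scope ring_scope.
Local Open Scope complex_scope.

Section NormedOperators.
Variables (R : realType) (H : completeNormedModType R[i]).

(* The norm of a module over R[i] takes its values in R[i], where they are real
   and nonnegative; suprema live in R. *)
Definition rnorm (x : H) : R := complex.Re `|x|.

Definition bounded_operator (B : H -> H) : Prop :=
  exists c : R, forall x, rnorm (B x) <= c * rnorm x.

(* Failure of "0 is an approximate eigenvalue of B", i.e. B is bounded below. *)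
Definition zero_notin_approx_spectrum (B : H -> H) : Prop :=
  exists2 c : R, 0 < c & forall x, c * rnorm x <= rnorm (B x).

End NormedOperators.

(* A complex Hilbert space is a complete normed module over R[i] whose norm
   comes from a positive definite Hermitian form; the forms {dot H for Num.conj}
   are linear in the first variable and conjugate-linear in the second. *)
Definition norm_from_dot (R : realType) (H : completeNormedModType R[i])
    (ip : {dot H for (@Num.conj R[i])}) : Prop :=
  forall x : H, `|x| ^+ 2 = ip x x.

Section HilbertOperators.
Variables (R : realType) (H : completeNormedModType R[i]).
Variable ip : {dot H for (@Num.conj R[i])}.

(* For bounded linear T on a Hilbert space, the Riesz representation theorem
   gives exactly one such z for each y; otherwise the default value is 0. *)
Definition adjoint (T : H -> H) : H -> H :=
  fun y => xget 0 [set z | forall x, ip (T x) y = ip x z].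

Definition residual (S B : H -> H) (u : H) : H :=
  S u - (ip (S u) (B u) / ip (B u) (B u)) *: B u.

(* The set is bounded above when S is a bounded operator, and the denominators
   are nonzero when 0 is not in the approximate point spectrum of B. *)
Definition translatable_radius (S B : H -> H) : R :=
  sup [set rnorm (residual S B u) | u in [set u : H | `|u| = 1]].

Definition radius_attained_at (S B : H -> H) (u : H) : Prop :=
  `|u| = 1 /\ rnorm (residual S B u) = translatable_radius S B.

End HilbertOperators.

(* Main.v *)
(* Put S = T - ((Tf, Af) / (Af, Af)) A, so that h = Sf is orthogonal to Af, and
   let M = |h|. Subtracting multiples of A from T does not change the residuals,
   hence |Su|^2 - |(Su, Au)|^2 / |Au|^2 <= M^2 |u|^2 for all u, with equality
   at u = f. Testing this on u = s f + x with s complex shows that f is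
   stationary, i.e. S* S f = M^2 f, and that |S| <= M: after stationarity the
   gap M^2 |u|^2 - |Su|^2 does not depend on s, while s can be chosen so that
   (Su, Au) = 0, or so that (Su, Au) stays constant and |Au| tends to infinity.
   Consequently the residuals of T* along A* are at most |S*| <= M, and at
   g = h / |h| one has S* g = M f, which is orthogonal to A* g since
   (f, A* g) = (Af, h) / M = 0; so the residual there is M. *)
Require Import Defs.
From HB Require Import structures.
From mathcomp Require Import all_boot all_order all_algebra sesquilinear.
From mathcomp Require Import complex ring.
From mathcomp Require Import all_classical all_reals all_analysis.
Set Implicit Arguments.
Unset Strict Implicit.

Import Order.TTheory GRing.Theory Num.Theory.
Import numFieldNormedType.Exports.
Local Open Scope classical_set_scope.
Local Open Scope ring_scope.

(** * Real cubics that are nonnegative on the half-line *)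

Lemma cubic_lead_ge0 (C : numFieldType) (c3 c2 c1 c0 : C) :
  c3 \is Num.real -> c2 \is Num.real -> c1 \is Num.real -> c0 \is Num.real ->
  (forall r, 0 <= r -> 0 <= c3 * r ^+ 3 + c2 * r ^+ 2 + c1 * r + c0) ->
  0 <= c3.
Proof.
move=> c3R c2R c1R c0R c_ge0; rewrite real_leNgt ?real0//; apply/negP => c3_lt0.
(* As [r >= 1], the lower terms are at most [s * r ^+ 2]; this [r] solves [c3 * r + s = c3], so the
   cubic is at most [c3 * r ^+ 2 < 0]. *)
pose s := `|c2| + `|c1| + `|c0|; pose r := 1 + s / - c3.
have s_ge0 : 0 <= s by rewrite !addr_ge0.
have r_ge1 : 1 <= r by rewrite lerDl divr_ge0// oppr_ge0 ltW.
have r_ge0 : 0 <= r by apply: le_trans r_ge1.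
have r2_ge1 : 1 <= r ^+ 2 by rewrite exprn_ege1.
suff: c3 * r ^+ 3 + c2 * r ^+ 2 + c1 * r + c0 < 0.
  by move=> /(le_lt_trans (c_ge0 r r_ge0)); rewrite ltxx.
apply: (@le_lt_trans _ _ (c3 * r ^+ 3 + s * r ^+ 2)).
  rewrite -!addrA lerD2l !mulrDl addrA; apply: lerD; first apply: lerD.
  - by rewrite ler_wpM2r ?real_ler_norm// exprn_ge0.
  - apply: (@le_trans _ _ (`|c1| * r)); first by rewrite ler_wpM2r ?real_ler_norm.
    by rewrite ler_wpM2l// expr2 ler_peMl.
  - by rewrite (le_trans (real_ler_norm c0R))// ler_peMr.
have -> : c3 * r ^+ 3 + s * r ^+ 2 = c3 * r ^+ 2.
  by rewrite /r; field; rewrite lt_eqF.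
by rewrite nmulr_rlt0// exprn_gt0// (lt_le_trans ltr01).
Qed.

(** * Orthogonal rejection and the Cauchy-Schwarz inequality *)

Section DotProduct.
Variables (C : numClosedFieldType) (U : lmodType C).
Variable ip : {dot U for (@Num.conj C)}.
Implicit Types (u v w b x y : U).

Lemma dotC x y : ip x y = (ip y x)^*.
Proof. by rewrite hermC/= mul1r. Qed.

Lemma dotZl a x y : ip (a *: x) y = a * ip x y.
Proof. exact: linearZl_LR. Qed.

Lemma dotZr a x y : ip x (a *: y) = a^* * ip x y.
Proof. exact: linearZr_LR. Qed.

Lemma dot_real x : ip x x \is Num.real.
Proof. by rewrite ger0_real// dnorm_ge0. Qed.

(** The component of [w] orthogonal to [b]. For [b = 0] it is [w], so most identities below need no
    condition on [b]. *)
Definition rejection w b := w - (ip w b / ip b b) *: b.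

Lemma rejection_orthogonal w b : ip w b = 0 -> rejection w b = w.
Proof. by move=> wb0; rewrite /rejection wb0 mul0r scale0r subr0. Qed.

Lemma dot_rejectionl w b : ip (rejection w b) b = 0.
Proof.
have [->|b_neq0] := eqVneq b 0; first by rewrite linear0r.
by rewrite linearBl/= dotZl divfK ?subrr// dnorm_eq0.
Qed.

Lemma rejectionD w a b : rejection (w + a *: b) b = rejection w b.
Proof.
have [->|b_neq0] := eqVneq b 0; first by rewrite !scaler0 addr0.
rewrite /rejection linearDl/= dotZl mulrDl mulfK ?dnorm_eq0//.
by rewrite scalerDl opprD addrACA subrr addr0.
Qed.

Lemma rejectionZ a w b :
  a != 0 -> rejection (a *: w) (a *: b) = a *: rejection w b.
Proof.
move=> a_neq0; have [->|b_neq0] := eqVneq b 0.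
  by rewrite /rejection !(scaler0, subr0).
rewrite /rejection !(dotZl, dotZr) scalerBr !scalerA; congr (_ - _ *: _).
by field; rewrite dnorm_eq0 b_neq0 conjC_eq0 a_neq0.
Qed.

Lemma dnorm_rejection w b :
  ip (rejection w b) (rejection w b) = ip w w - `|ip w b| ^+ 2 / ip b b.
Proof.
rewrite {2}/rejection linearBr/= dotZr dot_rejectionl mulr0 subr0.
by rewrite linearBl/= dotZl (dotC b w) mulrAC -normCK.
Qed.

Lemma dnorm_rejection_le w b : ip (rejection w b) (rejection w b) <= ip w w.
Proof. by rewrite dnorm_rejection gerBl divr_ge0 ?exprn_ge0 ?dnorm_ge0. Qed.

Lemma dot_CauchySchwarz x y : `|ip x y| ^+ 2 <= ip x x * ip y y.
Proof.
have [->|y_neq0] := eqVneq y 0; first by rewrite !linear0r normr0 expr0n.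
rewrite -ler_pdivrMr ?dnorm_gt0// -subr_ge0 -dnorm_rejection.
exact: dnorm_ge0.
Qed.

End DotProduct.

(** * Linear equations in a complex number and its conjugate *)

Lemma conj_homogeneous_root (C : numClosedFieldType) (a b : C) :
  `|a| = `|b| -> exists2 z, z != 0 & z * a + z^* * b = 0.
Proof.
move=> ab; have [a0|a_neq0] := eqVneq a 0.
  have b0 : b = 0 by apply: normr0_eq0; rewrite -ab a0 normr0.
  by exists 1; rewrite ?oner_neq0// a0 b0 !mulr0 addr0.
(* Since [|b / a| = 1], also [|z| = 1], and multiplying the equation by [z] turns it into
   [z ^+ 2 * a + b = 0]. *)
pose z := sqrtC (- (b / a)).
have z2 : z * z * a = - b by rewrite -expr2 sqrtCK mulNr divfK.
have zz : z * z^* = 1.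
  apply: (@pexpIrn _ 2); rewrite ?nnegrE ?mul_conjC_ge0// ?ler01//.
  by rewrite -normCK -normrX sqrtCK normrN normf_div -ab divff// normr_eq0.
exists z; first by apply/eqP => z0; move/eqP: zz; rewrite z0 mul0r eq_sym oner_eq0.
have : z * (z * a + z^* * b) = 0 by rewrite mulrDr !mulrA z2 zz mul1r addNr.
move/eqP; rewrite mulf_eq0 => /orP[/eqP z0|/eqP//].
by move/eqP: zz; rewrite z0 mul0r eq_sym oner_eq0.
Qed.

Lemma conj_affine_root (C : numClosedFieldType) (a b d : C) :
  `|a| != `|b| -> exists s, s * a + s^* * b + d = 0.
Proof.
move=> ab; have ab2 : a * a^* - b * b^* != 0.
  by rewrite -!normCK subr_eq0 eqrXn2.
(* Cramer's rule for the equation and its conjugate, a linear system in [s] and [s^*] with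
   determinant [|a|^2 - |b|^2]. *)
exists ((b * d^* - a^* * d) / (a * a^* - b * b^*)).
rewrite rmorphM/= fmorphV/= !rmorphB/= !rmorphM/= !conjCK.
by field; move: ab2; rewrite mulrC (mulrC b).
Qed.

(** * Consequences of maximality at [f], with [m] the squared maximal residual *)

Section MaximalResidual.
Variables (C : numClosedFieldType) (U : lmodType C).
Variable ip : {dot U for (@Num.conj C)}.
Variables (S A : {linear U -> U}) (m : C) (f : U).
Hypothesis m_real : m \is Num.real.
Hypothesis Sf_norm : ip (S f) (S f) = m * ip f f.
Hypothesis Sf_orth : ip (S f) (A f) = 0.
Hypothesis Af_neq0 : A f != 0.
Hypothesis rejection_le : forall u,
  ip (rejection ip (S u) (A u)) (rejection ip (S u) (A u)) <= m * ip u u.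

Let gap u := m * ip u u - ip (S u) (S u).

Let gap_real u : gap u \is Num.real.
Proof. by rewrite realB ?realM ?dot_real. Qed.

(** This is [rejection_le] with the denominator [|A u|^2] cleared, so that along a line it becomes a
    polynomial inequality. *)
Let gap_ineq u : 0 <= gap u * ip (A u) (A u) + `|ip (S u) (A u)| ^+ 2.
Proof.
have [->|Au_neq0] := eqVneq (A u) 0.
  by rewrite !linear0r normr0 expr0n addr0.
rewrite addrC -lerBlDr sub0r -mulNr -ler_pdivlMr ?dnorm_gt0//.
by rewrite opprB lerBlDr -lerBlDl -dnorm_rejection rejection_le.
Qed.

(** There is no [|s|^2] term because [gap f = 0] by [Sf_norm]. In [crossD] that term vanishes by
    [Sf_orth]; hence [gap_ineq] is only cubic in the size of [s]. *)
Let gapD s x : let k := m * ip x f - ip (S x) (S f) in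
  gap (s *: f + x) = s * k^* + s^* * k + gap x.
Proof.
rewrite /= /gap (linearP S) !dnormD !dnormZ !dotZl Sf_norm.
rewrite !rmorphM !rmorphB !rmorphM/= (conj_Creal m_real).
rewrite (dotC ip x f) (dotC ip (S x) (S f)) !conjCK.
ring.
Qed.

Let crossD s x : ip (S (s *: f + x)) (A (s *: f + x)) =
  s * ip (S f) (A x) + s^* * ip (S x) (A f) + ip (S x) (A x).
Proof.
rewrite (linearP S) (linearP A) !(linearDl, linearDr)/= !(dotZl, dotZr).
by rewrite Sf_orth !mulr0 add0r addrA.
Qed.

Let normD (r z : C) x : r \is Num.real ->
  ip (A ((r * z) *: f + x)) (A ((r * z) *: f + x)) =
    (`|z| ^+ 2 * ip (A f) (A f)) * r ^+ 2 +
    (z * ip (A f) (A x) + (z * ip (A f) (A x))^*) * r + ip (A x) (A x).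
Proof.
move=> rR; rewrite (linearP A) dnormD dnormZ !dotZl.
by rewrite normrM exprMn real_normK// !rmorphM/= (conj_Creal rR); ring.
Qed.

(* For u = s f + x with s = - r k, the leading term of [gap_ineq] in r is
   - 2 |k|^4 |Af|^2 r^3, which forces k = 0. *)
Lemma maximal_residual_stationary x : ip (S x) (S f) = m * ip x f.
Proof.
pose k := m * ip x f - ip (S x) (S f).
suff k0 : k = 0 by apply/eqP; rewrite eq_sym -subr_eq0 -/k k0.
(* At [u = - r k f + x] the gap is [gap x - 2 q r], the cross term is [r e + d], and [|A u|^2] is
   [q al r^2 + B r + g]. *)
pose al := ip (A f) (A f); pose d := ip (S x) (A x).
pose e := - k * ip (S f) (A x) + (- k)^* * ip (S x) (A f).
pose B := - k * ip (A f) (A x) + (- k * ip (A f) (A x))^*.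
have al_gt0 : 0 < al by rewrite dnorm_gt0.
have BR : B \is Num.real by rewrite CrealE /B rmorphD/= conjCK addrC.
have edR : e * d^* + e^* * d \is Num.real.
  by rewrite CrealE rmorphD/= !rmorphM/= !conjCK addrC.
pose g := ip (A x) (A x); pose q := `|k| ^+ 2.
have gR : g \is Num.real by exact: dot_real.
have qR : q \is Num.real by rewrite realX// normr_real.
have alR : al \is Num.real by exact: dot_real.
apply/eqP; apply: contraT => k_neq0; suff : 0 <= - (2 * q * (q * al)).
  by rewrite oppr_ge0 lt_geF// !mulr_gt0// normr_gt0.
apply: (@cubic_lead_ge0 _ _ (gap x * (q * al) - 2 * q * B + `|e| ^+ 2)
  (gap x * B - 2 * q * g + (e * d^* + e^* * d)) (gap x * g + `|d| ^+ 2)).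
1-4: by do !first [exact: gap_real | exact: normr_real | exact: realn
  | assumption | rewrite realN | apply: realD | apply: realM | apply: realX].
move=> r r_ge0; have rR := ger0_real r_ge0.
have := gap_ineq ((r * - k) *: f + x).
rewrite gapD crossD normD// -/k -/al -/g -/d normrN -/q -/B.
rewrite (_ : _ * ip (S f) (A x) + _ + d = r * e + d); last first.
  by rewrite /e rmorphM/= (conj_Creal rR) mulrDr !mulrA.
rewrite normCK [(r * e + d)^*]rmorphD/= [(r * e)^*]rmorphM/= [(r * - k)^*]rmorphM/=
  [(- k)^*]rmorphN/= (conj_Creal rR).
congr (0 <= _); rewrite /q !normCK; ring.
Qed.

Lemma maximal_residual_norm x : ip (S x) (S x) <= m * ip x x.
Proof.
have gapfx s : gap (s *: f + x) = gap x.
  by rewrite gapD maximal_residual_stationary subrr conjC0 !mulr0 !add0r.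
rewrite -subr_ge0 -/(gap x).
pose a := ip (S f) (A x); pose b := ip (S x) (A f); pose d := ip (S x) (A x).
(* If the moduli differ, some [s] makes the cross term vanish; the rejection is then all of [S u],
   and [rejection_le] bounds the constant gap. *)
have [ab|ab] := eqVneq `|a| `|b|; last first.
  have [s sE] := conj_affine_root d ab.
  have := rejection_le (s *: f + x).
  by rewrite rejection_orthogonal ?crossD// -subr_ge0 -/(gap _) gapfx.
have [z z_neq0 zE] := conj_homogeneous_root ab.
pose al := ip (A f) (A f); pose g := ip (A x) (A x).
pose B := z * ip (A f) (A x) + (z * ip (A f) (A x))^*.
have alR : al \is Num.real by exact: dot_real.
have BR : B \is Num.real by rewrite CrealE /B rmorphD/= conjCK addrC.
have zal_gt0 : 0 < `|z| ^+ 2 * al.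
  by rewrite mulr_gt0 ?dnorm_gt0// exprn_gt0// normr_gt0.
rewrite -(pmulr_lge0 _ zal_gt0).
(* Along [r z] the cross term stays [d], so [gap_ineq] is quadratic in [r]; multiplying it by [r]
   gives a cubic with constant term 0. *)
apply: (@cubic_lead_ge0 _ _ (gap x * B) (gap x * g + `|d| ^+ 2) 0).
- by rewrite realM// ger0_real// ltW.
- by rewrite realM.
- by rewrite realD ?realM ?realX ?normr_real// dot_real.
- exact: real0.
move=> r r_ge0; have rR := ger0_real r_ge0.
have := gap_ineq ((r * z) *: f + x).
rewrite gapfx crossD normD// -/al -/g -/d -/B -/a -/b.
rewrite [(r * z)^*]rmorphM/= (conj_Creal rR) -!mulrA -mulrDr zE mulr0 add0r.
move=> /(mulr_ge0 r_ge0); congr (0 <= _); ring.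
Qed.
End MaximalResidual.

(** Lying above a real number forces [J x] to be real, so the infimum of the real parts serves. *)
Lemma complex_infimum (R : realType) (X : Type) (x0 : X) (J : X -> R[i]) (l : R) :
  (forall x, l%:C%C <= J x) -> exists m,
    (forall x, m <= J x) /\ (forall d, 0 < d -> exists x, J x < m + d).
Proof.
move=> J_ge; pose E := range (fun x => complex.Re (J x)).
have JE x : J x = (complex.Re (J x))%:C%C.
  by have := J_ge x; case: (J x) => a b; rewrite lecE/= => /andP[/eqP-> _].
have E_inf : has_inf E.
  split; first by exists (complex.Re (J x0)), x0.
  by exists l => _ [x _ <-]; rewrite -lecR -JE.
exists (inf E)%:C%C; split=> [x|d d_gt0].
  by rewrite JE lecR; apply: ge_inf; [exact: E_inf.2|exists x].
have dE : d = (complex.Re d)%:C%C by rewrite RRe_real// gtr0_real.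
have Re_d_gt0 : 0 < complex.Re d by rewrite -ltcR -dE.
have [_ [x _ <-] x_lt] := inf_adherent Re_d_gt0 E_inf.
by exists x; rewrite JE dE -rmorphD/= ltcR.
Qed.

Lemma complex_natSinv_lt (R : realType) (e : R[i]) : 0 < e ->
  \forall n \near \oo, n.+1%:R^-1 < e.
Proof.
move=> e_gt0; have eE : e = (complex.Re e)%:C%C by rewrite RRe_real// gtr0_real.
have Re_e_gt0 : 0 < complex.Re e by rewrite -ltcR -eE.
have := near_infty_natSinv_lt (PosNum Re_e_gt0).
by apply: filterS => n /=; rewrite eE -ltcR fmorphV/= rmorph_nat.
Qed.

(** * Riesz representation by minimization, and adjoints *)

Section HilbertSpace.
Variables (R : realType) (H : completeNormedModType R[i]).
Variable ip : {dot H for (@Num.conj R[i])}.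
Hypothesis ip_norm : norm_from_dot ip.
Implicit Types (x y z w : H).

Lemma rnormE x : `|x| = (rnorm x)%:C%C.
Proof. by rewrite /rnorm RRe_real// normr_real. Qed.

Lemma rnorm_le x y : (rnorm x <= rnorm y) = (`|x| <= `|y|).
Proof. by rewrite !rnormE lecR. Qed.

Lemma dnorm_le x y : (ip x x <= ip y y) = (`|x| <= `|y|).
Proof. by rewrite -!ip_norm ler_sqr ?nnegrE ?normr_ge0. Qed.

Lemma dot_le x y : `|ip x y| <= `|x| * `|y|.
Proof.
rewrite -ler_sqr ?nnegrE ?mulr_ge0 ?normr_ge0// exprMn !ip_norm.
exact: dot_CauchySchwarz.
Qed.

Section Riesz.
Variables (phi : {scalar H}) (c : R).
Hypothesis phi_bounded : forall x, `|phi x| <= c%:C%C * `|x|.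

(* Completing the square, J x = |x - z|^2 - |z|^2 when phi = (-, z). *)
Let J x := ip x x - (phi x + (phi x)^*).

Let phiD_le x : phi x + (phi x)^* <= 2 * (c%:C%C * `|x|).
Proof.
rewrite (le_trans (real_ler_norm _))//; first by rewrite CrealE rmorphD/= conjCK addrC.
by rewrite (le_trans (ler_normD _ _))// norm_conjC mulr_natl mulr2n lerD.
Qed.

Let J_ge x : (- c ^+ 2)%:C%C <= J x.
Proof.
rewrite /J -ip_norm; apply: (@le_trans _ _ (`|x| ^+ 2 - 2 * (c%:C%C * `|x|))).
  rewrite rnormE -subr_ge0.
  rewrite (_ : _ - _ = ((rnorm x - c) ^+ 2)%:C%C).
    by rewrite ler0c sqr_ge0.
  by rewrite !(rmorphB, rmorphN, rmorphXn)/=; ring.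
by rewrite lerD2l lerN2 phiD_le.
Qed.

Let JD x w : J (x + w) = J x + ip w w + ((ip w x - phi w) + (ip w x - phi w)^*).
Proof.
rewrite /J dnormD (raddfD phi) !rmorphD rmorphN/= -(dotC ip x w) (dotC ip w x).
ring.
Qed.

(** The contributions of [phi] cancel, which leaves the parallelogram law. It makes minimizing
    sequences Cauchy. *)
Let J_parallelogram x y :
  `|x - y| ^+ 2 = 2 * J x + 2 * J y - 4 * J (2^-1 *: (x + y)).
Proof.
rewrite ip_norm /J dnormZ dnormB dnormD scalarZ (raddfD phi) ger0_norm//.
rewrite !(rmorphM, rmorphD)/= fmorphV/= conjC_nat; by field.
Qed.

Let J_min : exists z, forall x, J z <= J x.
Proof.
have [m [m_le m_inf]] := complex_infimum 0 J_ge.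
have inv_gt0 n : 0 < n.+1%:R^-1 :> R[i] by rewrite invr_gt0 ltr0n.
have [u u_lt] := choice (fun n => m_inf _ (inv_gt0 n)).
have u_cauchy : cauchy (u @ \oo).
  apply: cauchy_exP => e e_gt0.
  (* The midpoint value of [J] is at least [m], so the squared distance is at most twice the sum of
     the two excesses over [m], each below [e ^+ 2 / 4]. *)
  have e2_gt0 : 0 < e ^+ 2 / 4 by rewrite divr_gt0 ?exprn_gt0 ?ltr0n.
  have [N _ N_lt] := complex_natSinv_lt e2_gt0.
  exists (u N), N => // n Nn; rewrite -ball_normE /ball_/=.
  suff : `|u N - u n| ^+ 2 < e ^+ 2 by rewrite ltr_sqr ?nnegrE ?(ltW e_gt0).
  rewrite J_parallelogram.
  apply: (@le_lt_trans _ _ (2 * N.+1%:R^-1 + 2 * n.+1%:R^-1)).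
    rewrite (_ : 2 * N.+1%:R^-1 + _ =
      2 * (m + N.+1%:R^-1) + 2 * (m + n.+1%:R^-1) - 4 * m); last by ring.
    by rewrite lerB ?lerD ?ler_wpM2l// ltW.
  rewrite (_ : e ^+ 2 = 2 * (e ^+ 2 / 4) + 2 * (e ^+ 2 / 4)); last by field.
  by rewrite ltrD// ltr_pM2l ?ltr0n//; apply: N_lt => /=.
have /cvg_ex[z uz] : cvg (u @ \oo) by exact: cauchy_cvg.
exists z => x; apply: le_trans (m_le x).
apply/ler_addgt0Pr => e e_gt0.
(* [K] times [|w|] bounds the first-order change of [J] from [z] to [z + w]; the added 1 keeps [K]
   positive. *)
pose K := 2 * (`|z| + `|c|%:C%C) + 1.
have K_gt0 : 0 < K by rewrite ltr_wpDl ?ltr01// mulr_ge0 ?addr_ge0// ler0c.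
have e2_gt0 : 0 < e / 2 by rewrite divr_gt0.
have eK_gt0 : 0 < e / 2 / K by rewrite divr_gt0.
have [N _ N_lt] := complex_natSinv_lt e2_gt0.
have [N' _ N'_lt] := cvgr_dist_lt _ _ uz _ eK_gt0.
pose n := maxn N N'.
have zu : `|z - u n| < e / 2 / K by apply: N'_lt; exact: leq_maxr.
have un : J (u n) < m + e / 2.
  by rewrite (lt_trans (u_lt n))// ltrD2l; apply: N_lt; exact: leq_maxl.
pose w := u n - z; have := JD z w; rewrite [z + w]addrC subrK.
set D := ip w z - phi w => JzE.
have wz : `|w| = `|z - u n| by rewrite distrC.
have D_le : `|D| <= `|w| * (`|z| + `|c|%:C%C).
  rewrite (le_trans (ler_normB _ _))// mulrDr lerD ?dot_le//.
  rewrite (le_trans (phi_bounded w))// mulrC ler_wpM2l//.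
  by rewrite lecR ler_norm.
have DD_le : - (D + D^*) <= e / 2.
  have DR : - (D + D^*) \is Num.real by rewrite realN CrealE rmorphD/= conjCK addrC.
  rewrite (le_trans (real_ler_norm DR))// normrN (le_trans (ler_normD _ _))//.
  rewrite norm_conjC -(divfK (lt0r_neq0 K_gt0) (e / 2)).
  apply: (@le_trans _ _ (`|w| * K)); last by rewrite ler_wpM2r ?wz// ltW.
  rewrite /K mulrDr mulr1 (le_trans (lerD D_le D_le))//.
  rewrite (_ : _ * (2 * _) = `|w| * (`|z| + `|c|%:C%C) + `|w| * (`|z| + `|c|%:C%C));
    last by ring.
  by rewrite lerDl.
have -> : J z = J (u n) - ip w w - (D + D^*) by rewrite JzE; ring.
rewrite [e]splitr addrA lerD// lerBlDr (le_trans (ltW un))// lerDl dnorm_ge0//.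
Qed.

Lemma riesz_representation : exists z, forall x, phi x = ip x z.
Proof.
have [z z_min] := J_min; exists z => w.
(* Moving from [z] by [- s D^* w] changes [J] by [|D|^2 (s^2 |w|^2 - 2 s)]. This [s] gives
   [s^2 |w|^2 = s - s^2], so the change is negative unless [D = 0]. *)
pose D := ip w z - phi w; pose s := (1 + ip w w)^-1.
suff D0 : D = 0 by apply/eqP; rewrite eq_sym -subr_eq0 -/D D0.
have ww1_gt0 : 0 < 1 + ip w w by rewrite ltr_pwDl ?ltr01// dnorm_ge0.
have s_gt0 : 0 < s by rewrite invr_gt0.
have sR : s \is Num.real by exact: gtr0_real.
have := z_min (z + (- s * D^*) *: w).
rewrite JD dnormZ dotZl scalarZ -mulrBr -/D -addrA lerDl.
rewrite normrM normrN (gtr0_norm s_gt0) norm_conjC.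
rewrite (_ : - s * D^* * D = - (s * `|D| ^+ 2)); last by rewrite normCK; ring.
rewrite [(- _)^*]conj_Creal; last by rewrite realN realM// realX// normr_real.
rewrite (_ : _ + _ = - (`|D| ^+ 2 * (s + s ^+ 2))); last first.
  by rewrite /s; field; rewrite lt0r_neq0.
rewrite oppr_ge0 pmulr_lle0 ?addr_gt0 ?exprn_gt0// => D_le0.
by apply: normr0_eq0; apply/eqP; rewrite -sqrf_eq0 eq_le D_le0 exprn_ge0.
Qed.

End Riesz.

(** Riesz, applied to the functional sending [v] to [ip (T v) y], makes the set in [adjoint]
    inhabited, so [xget] does not fall back on 0. *)
Lemma adjointP (T : {linear H -> H}) : bounded_operator T ->
  forall x y, ip (T x) y = ip x (adjoint ip T y).
Proof.
move=> [c Tc] x y; suff Tz : exists z, [set z | forall x, ip (T x) y = ip x z] z.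
  exact: (xgetPex 0 Tz).
have [|z zP] := @riesz_representation (applyr ip y \o T) (c * rnorm y).
  move=> v /=; apply: le_trans (dot_le _ _) _.
  rewrite rmorphM/= -rnormE mulrAC ler_wpM2r//.
  by rewrite !rnormE -rmorphM/= lecR.
by exists z => v; rewrite -zP.
Qed.

Lemma dotIr y z : (forall x, ip x y = ip x z) -> y = z.
Proof.
move=> yz; apply/eqP; rewrite -subr_eq0 -(dnorm_eq0 ip) linearBr/=.
by rewrite yz subrr.
Qed.

End HilbertSpace.

(** * Transfer of the maximum to the adjoints *)

Unset Implicit Arguments.
Local Open Scope complex_scope.

Theorem corollary1 (R : realType) (H : completeNormedModType R[i])
    (ip : {dot H for (@Num.conj R[i])}) (ip_norm : norm_from_dot ip)
    (T A : {linear H -> H})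
    (T_bounded : bounded_operator T) (A_bounded : bounded_operator A)
    (A_spec : zero_notin_approx_spectrum A)
    (Aadj_spec : zero_notin_approx_spectrum (adjoint ip A))
    (f : H) (f_attains : radius_attained_at ip T A f) :
  let h := T f - (ip (T f) (A f) / ip (A f) (A f)) *: A f in
  h != 0 ->
  radius_attained_at ip (adjoint ip T) (adjoint ip A) (`|h|^-1 *: h).
Proof.
move=> h h_neq0; have [f1 f_max] := f_attains.
pose lam := ip (T f) (A f) / ip (A f) (A f).
pose S : {linear H -> H} := T \- lam \*: A.
have TS u : T u = S u + lam *: A u by rewrite /= subrK.
pose m := ip h h.
have m_gt0 : 0 < m by rewrite dnorm_gt0.
have mR : m \is Num.real by exact: gtr0_real.
have ff : ip f f = 1 by rewrite -ip_norm f1 expr1n.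
have Af_neq0 : A f != 0.
  have [c c_gt0 /(_ f) Ac] := A_spec; rewrite -normr_gt0 rnormE ltcR.
  by rewrite (lt_le_trans _ Ac)// mulr_gt0// -ltcR -rnormE f1 ltr01.
have Sf_norm : ip (S f) (S f) = m * ip f f by rewrite ff mulr1.
have Sf_orth : ip (S f) (A f) = 0 by exact: dot_rejectionl.
have resE u : rejection ip (S u) (A u) = residual ip T A u.
  by rewrite /residual -/(rejection ip _ _) TS rejectionD.
(* Only for a set bounded above does [sup] dominate its members; [S_le] uses this at unit vectors
   and extends it by homogeneity. *)
have T_ub : has_ubound [set rnorm (residual ip T A u) | u in [set u : H | `|u| = 1]].
  have [c Tc] := T_bounded; exists c => _ [u /= u1 <-].
  have -> : c = c * rnorm u by rewrite /rnorm u1 mulr1.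
  apply: le_trans (Tc u); rewrite rnorm_le -(dnorm_le ip_norm).
  exact: dnorm_rejection_le.
have S_le u : ip (rejection ip (S u) (A u)) (rejection ip (S u) (A u)) <= m * ip u u.
  have [->|u_neq0] := eqVneq u 0.
    by rewrite (raddf0 S) (raddf0 A) /rejection scaler0 subr0 linear0r mulr0.
  have nu_neq0 : `|u| != 0 by rewrite normr_eq0.
  have [v v1 uE] : exists2 v : H, `|v| = 1 & u = `|u| *: v.
    exists (`|u|^-1 *: u); first by rewrite normrZ normfV normr_id mulVf.
    by rewrite scalerA divff// scale1r.
  have : rnorm (residual ip T A v) <= rnorm h.
    by rewrite [leRHS]f_max; apply: ub_le_sup => //; exists v.
  rewrite rnorm_le -(dnorm_le ip_norm) -/m -resE => v_le.
  rewrite uE (linearZ_LR S) (linearZ_LR A)/= rejectionZ// !dnormZ (mulrCA m) normr_id.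
  by rewrite ler_wpM2l ?exprn_ge0// -(ip_norm v) v1 expr1n mulr1.
have stat := maximal_residual_stationary mR Sf_norm Sf_orth Af_neq0 S_le.
have S_norm := maximal_residual_norm mR Sf_norm Sf_orth Af_neq0 S_le.
(* The adjoint of [S], written pointwise; [S'P] is all that is used of its relation to [S]. *)
pose S' y := adjoint ip T y - lam^* *: adjoint ip A y.
have S'P x y : ip (S x) y = ip x (S' y).
  by rewrite /S' linearBl linearBr/= dotZl dotZr conjCK !adjointP.
have res'E u : residual ip (adjoint ip T) (adjoint ip A) u =
    rejection ip (S' u) (adjoint ip A u).
  by rewrite -(rejectionD _ _ lam^*) subrK.
have S'_le u : ip (S' u) (S' u) <= m * ip u u.
  have [->|S'u_neq0] := eqVneq (S' u) 0.
    by rewrite linear0r mulr_ge0 ?dnorm_ge0// ltW.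
  have S'u_gt0 : 0 < ip (S' u) (S' u) by rewrite dnorm_gt0.
  rewrite -(ler_pM2l S'u_gt0).
  (* [|S' u|^4 = |(S S' u, u)|^2 <= |S S' u|^2 |u|^2 <= m |S' u|^2 |u|^2], and a factor [|S' u|^2]
     cancels. *)
  have := dot_CauchySchwarz ip (S (S' u)) u.
  rewrite S'P (ger0_norm (dnorm_ge0 _ _)) expr2 => /le_trans; apply.
  by rewrite mulrCA mulrA ler_wpM2r ?dnorm_ge0//; apply: S_norm.
have h_gt0 : 0 < `|h| by rewrite normr_gt0.
pose g := `|h|^-1 *: h; rewrite -/g.
have g1 : `|g| = 1 by rewrite normrZ normfV normr_id mulVf// lt0r_neq0.
(* Since [h = S f], stationarity gives [(x, S' g) = (S x, S f) / |h| = |h| (x, f)] for every [x]. *)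
have S'g : S' g = `|h| *: f.
  apply: (dotIr (ip := ip)) => x; rewrite -S'P /g !dotZr.
  rewrite -[ip (S x) h]/(ip (S x) (S f)) stat /m -ip_norm.
  rewrite !conj_Creal ?realV ?normr_real//.
  by field; rewrite lt0r_neq0.
have res_g : residual ip (adjoint ip T) (adjoint ip A) g = S' g.
  rewrite res'E rejection_orthogonal// S'g dotZl -adjointP//.
  by rewrite /g dotZr -[h]/(S f) dotC Sf_orth conjC0 !mulr0.
have res_g_norm : rnorm (residual ip (adjoint ip T) (adjoint ip A) g) = rnorm h.
  by rewrite res_g S'g /rnorm normrZ normr_id f1 mulr1.
split=> //; rewrite res_g_norm.
have ub : ubound [set rnorm (residual ip (adjoint ip T) (adjoint ip A) u)
    | u in [set u : H | `|u| = 1]] (rnorm h).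
  move=> _ [u /= u1 <-]; rewrite rnorm_le -(dnorm_le ip_norm) res'E.
  rewrite (le_trans (dnorm_rejection_le _ _ _))// (le_trans (S'_le u))//.
  by rewrite -ip_norm u1 expr1n mulr1.
apply/eqP; rewrite eq_le; apply/andP; split.
  by apply: ub_le_sup; [exists (rnorm h)|exists g].
by apply: ge_sup => //; exists (rnorm h), g.
Qed.
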